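(* Let $n,q,\delta$ be non-negative integers with $n\ge 1$ and $q\le n$, let $c\in[0,1]$ be real, and put $$\alpha=\lceil(1-(1-c)^\delta)\,n\rceil,\qquad a=\max(0,\alpha-n+q),\qquad b=\min(\alpha,q).$$ Consider a system that at time $\tau$ consists of $n$ nodes, $q$ of which form the initial core. By time $\tau'=\tau+\delta$, $\alpha$ of the $n$ initial nodes, chosen uniformly at random among all $\alpha$-element subsets, have been replaced by $\alpha$ new nodes, which do not belong to the initial core. Let $x_1,\dots,x_q$ be $q$ nodes drawn successively, uniformly at random and without replacement, from the $n$ nodes of the system at time $\tau'$, independently of which nodes were replaced. Then the probability that none of the nodes $x_1,\dots,x_q$ belongs to the initial core is $$\frac{\displaystyle\sum_{k=a}^{b}\binom{n+k-q}{q}\binom{q}{k}\binom{n-q}{\alpha-k}}{\displaystyle\binom{n}{q}\binom{n}{\alpha}}.$$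
   Context: The system is dynamic with constant size $n$: per time unit a fraction $c$ of the nodes leaves and is replaced by the same number of new nodes; a node that has left never re-enters. The core is a set of $q$ nodes present at time $\tau$ (those owning a copy of some critical data). The number of initial nodes (nodes present at time $\tau$) that have been replaced by time $\tau+\delta$ is taken to be $\alpha=\lceil(1-(1-c)^\delta)n\rceil$. Thus the nodes at time $\tau'$ are the $n-\alpha$ remaining initial nodes together with $\alpha$ new nodes. Binomial coefficients follow the convention $\binom{m}{j}=0$ for integers $0\le m<j$. *)

(* Defs.v *)
From HB Require Import structures.
From mathcomp Require Import all_boot all_order all_algebra.
From mathcomp Require Import all_classical all_reals all_analysis.

Set Implicit Arguments.
Unset Strict Implicit.
Unset Printing Implicit Defensive.

Import Order.TTheory GRing.Theory Num.Theory.
Local Open Scope classical_set_scope.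
Local Open Scope ring_scope.

(** The number of initial nodes replaced after [delta] time units, when a
    fraction [c] of the [n] nodes is renewed per time unit.  For [0 <= c <= 1]
    the ceiling is nonnegative, so that the integer absolute value is a mere
    cast from [int] to [nat]. *)
Definition replaced_count (R : realType) (c : R) (delta n : nat) : nat :=
  `|Num.ceil ((1 - (1 - c) ^+ delta) * n%:R)|%N.

Section random_elements.
Context (d : measure_display) (Omega : measurableType d) (R : realType).

(** A random element of the finite set [V], carrying the discrete
    sigma-algebra. *)
Definition random_element (V : finType) (Y : Omega -> V) : Prop :=
  forall v : V, measurable (Y @^-1` [set v]).

(** Given the event [E], [Y] is uniformly distributed on the (nonempty) finite
    set [D].  This is P(Y = v | E) = 1 / #|D| for [v] in [D], multiplied by
    P(E): it puts no constraint when P(E) = 0. *)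
Definition uniform_given (P : probability Omega R) (V : finType)
    (E : set Omega) (Y : Omega -> V) (D : {set V}) : Prop :=
  forall v : V, v \in D ->
    P (E `&` Y @^-1` [set v]) = (P E * (#|D|%:R^-1)%:E)%E.

End random_elements.

Section churn.
Context (V : finType).

Definition replaceable_sets (init : {set V}) (alpha : nat) : {set {set V}} :=
  finset (fun S : {set V} => (S \subset init) && (#|S| == alpha)).

Definition system_after (init new S : {set V}) : {set V} :=
  ((init :\: S) :|: new)%SET.

(** The nodes that can still be drawn at step [i], when the earlier draws are
    given by the history [y] (only the [y j] with [j < i] matter). *)
Definition remaining (q : nat) (init new S : {set V}) (y : 'I_q -> V)
    (i : 'I_q) : {set V} :=
  finset (fun v => (v \in system_after init new S) &&
                   [forall j : 'I_q, (j < i)%N ==> (y j != v)]).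

Context (d : measure_display) (Omega : measurableType d) (R : realType).

(** The event that exactly the nodes in [S] have been replaced and that the
    draws before step [i] are those of the history [y]. *)
Definition past (q : nat) (A : Omega -> {set V}) (X : 'I_q -> Omega -> V)
    (S : {set V}) (y : 'I_q -> V) (i : 'I_q) : set Omega :=
  [set w | A w = S /\ forall j : 'I_q, (j < i)%N -> X j w = y j].

(** [X] is drawn successively, uniformly and without replacement from the
    system obtained once the random set [A] has been replaced by [new].  The
    nodes that may be drawn depend on [A], so the independence of the drawing
    from the replacement means that, conditionally on each value of [A], each
    draw is uniform among the nodes of the resulting system not yet drawn. *)
Definition drawn_without_replacement (P : probability Omega R) (q : nat)
    (init new : {set V}) (A : Omega -> {set V}) (X : 'I_q -> Omega -> V)
    : Prop :=
  forall (S : {set V}) (y : 'I_q -> V) (i : 'I_q),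
    uniform_given P (past A X S y i) (X i) (remaining init new S y i).

End churn.

(* Main.v *)
Require Import Defs.
From HB Require Import structures.
From mathcomp Require Import all_boot all_order all_algebra.
From mathcomp Require Import all_classical all_reals all_analysis.
From mathcomp Require Import zify ring.

(** The pair (set of replaced nodes, sequence of draws) is uniform on the pairs
    [(S, y)] with [S] an [alpha]-subset of [init] and [y] injective into the
    system left by [S]: the chain rule gives each such pair the mass
    [1 / ('C(n, alpha) * n ^_ q)], and there are ['C(n, alpha) * n ^_ q] of
    them.  If [S] contains [k] core nodes, then [n + k - q] nodes of the
    system are outside the core, so [(n + k - q) ^_ q] of the [y] avoid it;
    sorting the [S] by [k] and dividing by [q`!] gives the formula. *)

Set Implicit Arguments.
Unset Strict Implicit.
Unset Printing Implicit Defensive.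

Import Order.TTheory GRing.Theory Num.Theory.

(** * Counting the possible sets of replaced nodes *)

Lemma card_draws_meet (T : finType) (B C : {set T}) (m k : nat) :
  C \subset B -> (k <= m)%N ->
  #|finset (fun S : {set T} =>
      [&& S \subset B, #|S| == m & #|(S :&: C)%SET| == k])| =
  ('C(#|C|, k) * 'C(#|B| - #|C|, m - k))%N.
Proof.
move=> sCB km.
have cBC : #|(B :\: C)%SET| = (#|B| - #|C|)%N by rewrite cardsDS.
rewrite -cBC -!cards_draws -cardsX.
(* Such an [S] is the union of [U], a [k]-subset of [C], and [W], an [(m - k)]-subset of [B :\: C].
   The pair is recovered from the union, which agrees with [U] on [C] and with [W] off [C]. The
   bound [k <= m] makes the two sizes add up to [m] despite the truncated subtraction. *)
rewrite -(@card_in_imset _ _ (fun p : {set T} * {set T} => (p.1 :|: p.2)%SET)).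
  congr #|pred_of_set _|; apply/setP => S; rewrite inE.
  apply/idP/imsetP => [/and3P[sSB /eqP cS /eqP cSC]|[[U W]]].
    exists ((S :&: C)%SET, (S :\: C)%SET); last by rewrite /= finset.setID.
    by rewrite !inE /= finset.subsetIr cSC eqxx finset.setSD//= cardsD cS cSC eqxx.
  rewrite !inE /= => /andP[/andP[sUC /eqP cU] /andP[]].
  rewrite finset.subsetD => /andP[sWB dWC] /eqP cW ->.
  have WC0 : (W :&: C = finset.set0)%SET by apply/eqP; rewrite setI_eq0.
  have WU0 : (U :&: W = finset.set0)%SET.
    by apply/eqP; rewrite finset.setIC setI_eq0; exact: disjointWr sUC dWC.
  rewrite finset.subUset (fintype.subset_trans sUC sCB) sWB /=.
  rewrite cardsU WU0 cards0 subn0 cU cW subnKC// eqxx /=.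
  by rewrite finset.setIUl WC0 finset.setU0 (finset.setIidPl sUC) cU.
move=> [U W] [U' W']; rewrite !inE /=.
move=> /andP[/andP[sUC _] /andP[]]; rewrite finset.subsetD => /andP[_ dW] _.
move=> /andP[/andP[sUC' _] /andP[]]; rewrite finset.subsetD => /andP[_ dW'] _ eqUW.
congr pair; apply/setP => x; move/setP/(_ x) : eqUW; rewrite !inE;
  case: (boolP (x \in C)) => xC.
- by rewrite (disjointFl dW xC) (disjointFl dW' xC) !orbF.
- by rewrite (negbTE (contra (fintype.subsetP sUC x) xC))
    (negbTE (contra (fintype.subsetP sUC' x) xC)).
- by rewrite (disjointFl dW xC) (disjointFl dW' xC).
- by rewrite (negbTE (contra (fintype.subsetP sUC x) xC))
    (negbTE (contra (fintype.subsetP sUC' x) xC)).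
Qed.

(** The sets [S] are grouped by the size [k] of their trace on [C]; each group has the
    hypergeometric size given by [card_draws_meet]. *)
Lemma sum_draws_meet (T : finType) (B C : {set T}) (m : nat) (F : nat -> nat) :
  C \subset B ->
  (\sum_(S in replaceable_sets B m) F #|(S :&: C)%SET| =
   \sum_(m + #|C| - #|B| <= k < (minn m #|C|).+1)
     F k * ('C(#|C|, k) * 'C(#|B| - #|C|, m - k)))%N.
Proof.
move=> sCB; set b := minn m _.
(* This bound ensures that [inord] below returns the size of the trace and not its default value. *)
have ltb (S : {set T}) :
    S \in replaceable_sets B m -> (#|(S :&: C)%SET| < b.+1)%N.
  rewrite inE => /andP[_ /eqP cS].
  rewrite ltnS leq_min -{1}cS.
  by rewrite !subset_leq_card ?finset.subsetIl ?finset.subsetIr.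
rewrite (partition_big (fun S : {set T} => inord #|(S :&: C)%SET| : 'I_b.+1)
  predT)//=.
rewrite (eq_bigr (fun k : 'I_b.+1 =>
    F k * ('C(#|C|, k) * 'C(#|B| - #|C|, m - k)))%N); last first.
  move=> k _; have km : (k <= m)%N.
    by have := ltn_ord k; rewrite ltnS leq_min => /andP[].
  rewrite (eq_bigr (fun=> F k)); last first.
    by move=> S /andP[/ltb Sb /eqP <-]; rewrite inordK.
  rewrite sum_nat_const mulnC -(card_draws_meet sCB km); congr muln.
  apply: eq_card => S; rewrite [RHS]inE unfold_in.
  case: (boolP (S \in replaceable_sets B m)) => [SB|].
    rewrite -val_eqE /= inordK ?ltb//.
    by move: SB; rewrite inE => /andP[-> ->].
  by rewrite inE => /nandP[] /negbTE -> //=; rewrite andbF.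
rewrite -(big_mkord xpredT (fun k =>
  F k * ('C(#|C|, k) * 'C(#|B| - #|C|, m - k))))%N.
have sCB' := subset_leq_card sCB.
set a := (m + _ - _)%N.
(* Below [a], more than [#|B| - #|C|] elements would have to be chosen outside [C]. *)
have zero k : (k < a)%N -> (F k * ('C(#|C|, k) * 'C(#|B| - #|C|, m - k)) = 0)%N.
  move=> ka; rewrite [X in (_ * (_ * X))%N]bin_small ?muln0//.
  by move: ka; rewrite /a; lia.
(* The second case occurs only for [m > #|B|]: the right-hand range is then empty, and every index
   on the left is below [a]. *)
have [ab|ab] := leqP a b.+1.
  by rewrite (big_cat_nat (n := a))//= big_nat big1 ?add0n.
rewrite [RHS]big_geq ?(ltnW ab)// big_nat big1// => k kb.
by apply: zero; exact: ltn_trans ab.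
Qed.

Local Open Scope classical_set_scope.
Local Open Scope ring_scope.

(** Since [(1 - c) ^+ delta] lies between 0 and 1, so does the replaced proportion. The bound makes
    ['C(n, alpha)] positive. *)
Lemma replaced_count_le (R : realType) (c : R) (delta n : nat) :
  0 <= c <= 1 -> (replaced_count c delta n <= n)%N.
Proof.
move=> /andP[c0 c1]; rewrite /replaced_count.
have p0 : 0 <= (1 - c) ^+ delta by rewrite exprn_ge0// subr_ge0.
have p1 : (1 - c) ^+ delta <= 1 by rewrite exprn_ile1 ?subr_ge0// gerBl.
have u0 : 0 <= (1 - (1 - c) ^+ delta) * n%:R :> R by rewrite mulr_ge0// subr_ge0.
rewrite -lez_nat gez0_abs; last by rewrite ceil_ge0 (lt_le_trans _ u0)// ltrN10.
rewrite ceil_le_int.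
by rewrite -[leRHS]mul1r ler_wpM2r// gerBl.
Qed.

(** * Law of a random element of a finite set *)

Section discrete.
Context (d : measure_display) (Omega : measurableType d) (R : realType).
Context (P : probability Omega R) (W : finType) (Z : Omega -> W).
Hypothesis Z_random : random_element Z.

Lemma probability_preimage (B : {set W}) :
  P [set w | Z w \in B] = (\sum_(z in B) P (Z @^-1` [set z]))%E.
Proof.
rewrite -big_enum /=.
have -> : [set w | Z w \in B] = [set w | Z w \in enum B].
  by apply/seteqP; split => w /=; rewrite mem_enum.
(* Measurability is carried through the induction because additivity needs it for the tail of the
   enumeration. *)
suff [] : measurable [set w | Z w \in enum B] /\
  P [set w | Z w \in enum B] = (\sum_(z <- enum B) P (Z @^-1` [set z]))%E by [].
elim: (enum B) (enum_uniq B) => [_|z s IH /= /andP[zs /IH[ms Ps]]].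
  rewrite big_nil (_ : [set _ | _] = set0) ?measure0//.
  by apply/seteqP; split.
have -> : [set w | Z w \in z :: s] = Z @^-1` [set z] `|` [set w | Z w \in s].
  apply/seteqP; split => w /=; rewrite inE.
    by case/orP => [/eqP|]; [left|right].
  by case=> [->|->]; rewrite ?eqxx ?orbT.
split; first exact: measurableU.
rewrite big_cons measureU//; first by congr (_ + _)%E.
by apply/seteqP; split => w //= [->]; apply/negP.
Qed.

(* The points of [G] already carry the whole mass, so all others are null. *)
Lemma probability_uniform_support (G B : {set W}) :
  (0 < #|G|)%N ->
  (forall z, z \in G -> P (Z @^-1` [set z]) = (#|G|%:R^-1)%:E) ->
  P [set w | Z w \in B] = (#|(B :&: G)%SET|%:R / #|G|%:R)%:E.
Proof.
move=> G0 ZG.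
have sumG (C : {set W}) : C \subset G ->
    P [set w | Z w \in C] = (#|C|%:R / #|G|%:R)%:E.
  move=> /fintype.subsetP sCG; rewrite probability_preimage.
  rewrite (eq_bigr (fun=> (#|G|%:R^-1)%:E)) => [|z /sCG /ZG//].
  by rewrite sumEFin sumr_const mulr_natl.
have mZ (C : {set W}) : measurable [set w | Z w \in C].
  rewrite (_ : [set _ | _] = \bigcup_(z in [set` C]) Z @^-1` [set z]).
    by apply: fin_bigcup_measurable => [|z _]; [exact: finite_finset|].
  apply/seteqP; split => w /=; last by case=> z /= zC ->.
  move=> wC.
  by exists (Z w).
have nullG : P [set w | Z w \in (~: G)%SET] = 0.
  have -> : [set w | Z w \in (~: G)%SET] = ~` [set w | Z w \in G].
    by apply/seteqP; split => w /=; rewrite inE => /negP.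
  rewrite probability_setC// sumG// divff ?pnatr_eq0 -?lt0n//.
  by rewrite subee.
rewrite -sumG ?finset.subsetIr//.
have -> : [set w | Z w \in B] =
    [set w | Z w \in (B :&: G)%SET] `|` [set w | Z w \in (B :\: G)%SET].
  apply/seteqP; split => w /=; rewrite !inE.
    by move=> ->; case: (Z w \in G); [left|right].
  by case=> /andP[].
apply: measureU0 => //.
apply: (subset_measure0 _ _ _ nullG) => //.
by move=> w /=; rewrite !inE => /andP[].
Qed.

End discrete.

(** * Chain rule for the successive draws *)

Lemma card_remaining (V : finType) (q : nat) (init new S : {set V})
    (y : 'I_q -> V) (i : 'I_q) :
  injective y -> (forall j, y j \in system_after init new S) ->
  #|remaining init new S y i| = (#|system_after init new S| - i)%N.
Proof.
move=> inj_y yD; set D := system_after _ _ _.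
(* The earlier draws form the image of the indices below [i]; as [y] is injective, they are [i]
   distinct nodes of the system. *)
have -> : remaining init new S y i =
    (D :\: y @: finset (fun j : 'I_q => (j < i)%N))%SET.
  apply/setP => v; rewrite !inE andbC; congr andb.
  apply/forallP/negP => [yv /imsetP[j]|yv j].
    by rewrite inE => ji vj; have := yv j; rewrite ji vj eqxx.
  apply/implyP => ji; apply/eqP => vj; apply: yv.
  by apply/imsetP; exists j; rewrite ?inE ?vj.
rewrite cardsDS; last by apply/fintype.subsetP => _ /imsetP[j _ ->].
rewrite card_imset//; congr subn.
rewrite -sum1_card (eq_bigl (fun j : 'I_q => (j < i)%N)); last first.
  by move=> j; rewrite inE.
by rewrite -(big_ord_widen _ (fun=> 1%N)) ?sum1_card ?card_ord// ltnW.
Qed.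

Section churn.
Context (R : realType) (n q : nat) (d : measure_display).
Context (Omega : measurableType d) (P : probability Omega R).
Context (V : finType) (init new : {set V}).
Hypotheses (card_init : #|init| = n)
  (new_init : [disjoint new & init]%bool).

Lemma card_system_after (S : {set V}) :
  S \subset init -> #|S| = #|new| -> #|system_after init new S| = n.
Proof.
move=> sS cS; rewrite cardsU.
have -> : ((init :\: S) :&: new = finset.set0)%SET.
  apply/eqP; rewrite setI_eq0 disjoint_sym.
  exact: disjointWr (finset.subsetDl _ _) new_init.
rewrite cards0 subn0 cardsDS// cS subnK// -cS -?card_init.
exact: subset_leq_card.
Qed.

Context (A : Omega -> {set V}) (X : 'I_q -> Omega -> V).
Hypothesis A_uniform :
  uniform_given P setT A (replaceable_sets init #|new|).
Hypothesis X_drawn : drawn_without_replacement P init new A X.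

(** Induction on the length of the prefix: the set [S] has mass [1 / 'C(n, #|new|)], and the draw at
    step [i] contributes the factor [1 / (n - i)]. The length is a natural number rather than an
    index, so that [i = q], the whole sequence, is covered. *)
Lemma probability_prefix (S : {set V}) (y : 'I_q -> V) (i : nat) :
  S \in replaceable_sets init #|new| -> injective y ->
  (forall j, y j \in system_after init new S) -> (i <= q)%N ->
  P [set w | A w = S /\ forall j : 'I_q, (j < i)%N -> X j w = y j] =
  (('C(n, #|new|) * n ^_ i)%N%:R^-1)%:E.
Proof.
move=> SA inj_y yD; elim: i => [_|i IH iq].
  have -> : [set w | A w = S /\ forall j : 'I_q, (j < 0)%N -> X j w = y j] =
      setT `&` A @^-1` [set S].
    by apply/seteqP; split => w /=; [case|move=> [_ ?]; split].
  rewrite A_uniform// probability_setT mul1e ffactn0 muln1.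
  by rewrite /replaceable_sets cards_draws card_init.
have cD : #|system_after init new S| = n.
  by move: SA; rewrite inE => /andP[? /eqP ?]; exact: card_system_after.
have -> : [set w | A w = S /\ forall j : 'I_q, (j < i.+1)%N -> X j w = y j] =
    past A X S y (Ordinal iq) `&` X (Ordinal iq) @^-1` [set y (Ordinal iq)].
  apply/seteqP; split => w /= [Aw]; last first.
    case: Aw => Aw Xw Xi; split => // j; rewrite ltnS leq_eqVlt => /orP[/eqP ji|].
      by rewrite (_ : j = Ordinal iq)//; exact: val_inj.
    exact: Xw.
  by move=> Xw; split; [split => // j /= ji|]; apply: Xw; rewrite //= ltnS ltnW.
(* Uniformity applies only to a node still available; injectivity of [y] says that [y] at this step
   was not drawn before. *)
rewrite X_drawn; last first.
  rewrite inE yD; apply/forallP => j; apply/implyP => /= ji.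
  by apply/eqP => /inj_y jE; move: ji; rewrite jE /= ltnn.
rewrite card_remaining// cD /past (IH (ltnW iq)).
by rewrite -EFinM -invfM -natrM ffactnSr mulnA.
Qed.

End churn.

(** * Joint law of the replaced set and the draws *)

Lemma card_dependent_pairs (T U : finType) (E : {set T}) (F : T -> {set U}) :
  #|finset (fun z : T * U => (z.1 \in E) && (z.2 \in F z.1))| =
  (\sum_(x in E) #|F x|)%N.
Proof.
rewrite -sum1_card.
rewrite (eq_bigl (fun z : T * U => (z.1 \in E) && (z.2 \in F z.1))).
  rewrite -(pair_big_dep (mem E) (fun x => mem (F x)) (fun _ _ => 1%N)) /=.
  by apply: eq_bigr => x _; rewrite sum1_card.
by move=> z; rewrite inE.
Qed.

(** Packing the draws into a finite function gives a single random element of a finite type, to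
    which [probability_uniform_support] applies. *)
Lemma random_element_pair (d : measure_display) (Omega : measurableType d)
    (V W : finType) (q : nat) (A : Omega -> V) (X : 'I_q -> Omega -> W) :
  random_element A -> (forall i, random_element (X i)) ->
  random_element (fun w => (A w, [ffun i => X i w])).
Proof.
move=> rA rX [S y].
have -> : (fun w => (A w, [ffun i => X i w])) @^-1` [set (S, y)] =
    A @^-1` [set S] `&` \bigcap_(i in setT) (X i @^-1` [set y i]).
  apply/seteqP; split => w /= [].
    by move=> <- <-; split => // i _ /=; rewrite ffunE.
  by move=> -> Xy; congr pair; apply/ffunP => i; rewrite ffunE; exact: Xy.
apply: measurableI => //.
by apply: fin_bigcap_measurable => [|i _]; [exact: finite_finset|exact: rX].
Qed.

Theorem theorem1 (R : realType) (n q delta : nat) (c : R)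
    (hn : (1 <= n)%N) (hqn : (q <= n)%N) (hc : 0 <= c <= 1)
    (d : measure_display) (Omega : measurableType d) (P : probability Omega R)
    (V : finType) (init core new : {set V})
    (card_init : #|init| = n)
    (core_init : core \subset init) (card_core : #|core| = q)
    (card_new : #|new| = replaced_count c delta n)
    (new_init : [disjoint new & init]%bool)
    (A : Omega -> {set V}) (X : 'I_q -> Omega -> V)
    (A_random : random_element A)
    (X_random : forall i : 'I_q, random_element (X i))
    (A_uniform : uniform_given P setT A
                   (replaceable_sets init (replaced_count c delta n)))
    (X_drawn : drawn_without_replacement P init new A X) :
  let alpha := replaced_count c delta n in
  (* truncated subtraction: a = max(0, alpha - n + q) *)
  let a := (alpha + q - n)%N in
  let b := minn alpha q in
  P [set w | forall i : 'I_q, X i w \notin core] =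
  ((\sum_(a <= k < b.+1)
      'C(n + k - q, q) * 'C(q, k) * 'C(n - q, alpha - k))%N%:R /
   ('C(n, q) * 'C(n, alpha))%N%:R)%:E.
Proof.
move=> alpha a b.
have alpha_le : (alpha <= n)%N := replaced_count_le delta n hc.
have sysE S : S \in replaceable_sets init alpha ->
    #|system_after init new S| = n /\
    #|(system_after init new S :\: core)%SET| = (n + #|(S :&: core)%SET| - q)%N.
  rewrite inE => /andP[sS /eqP cS].
  have cD : #|system_after init new S| = n.
    by apply: card_system_after => //; rewrite cS card_new.
  split => //; rewrite cardsD cD.
  (* New nodes are outside [init], hence outside [core], so the core nodes still present are exactly
     those not replaced. *)
  have -> : (system_after init new S :&: core = core :\: S)%SET.
    apply/setP => v; rewrite !inE.
    case: (boolP (v \in core)) => vc; rewrite ?andbF// ?andbT.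
    have vi := fintype.subsetP core_init v vc.
    by rewrite vi (disjointFl new_init vi) orbF andbT.
  rewrite cardsD card_core finset.setIC subnBA//.
  by rewrite -card_core subset_leq_card// finset.subsetIr.
pose draws (D : {set V}) : {set {ffun 'I_q -> V}} :=
  finset (fun y => (y \in ffun_on D) && injectiveb y).
have card_draws_ff D : #|draws D| = (#|D| ^_ q)%N.
  by rewrite card_inj_ffuns_on card_ord.
pose G := finset (fun z : {set V} * {ffun 'I_q -> V} =>
  (z.1 \in replaceable_sets init alpha) &&
  (z.2 \in draws (system_after init new z.1))).
pose B := finset (fun z : {set V} * {ffun 'I_q -> V} =>
  [forall i, z.2 i \notin core]).
have cG : #|G| = ('C(n, alpha) * n ^_ q)%N.
  rewrite (card_dependent_pairs _ (fun S => draws (system_after init new S))).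
  rewrite (eq_bigr (fun=> n ^_ q)%N); last first.
    by move=> S /sysE[cD _]; rewrite card_draws_ff cD.
  by rewrite sum_nat_const cards_draws card_init.
have cBG : #|(B :&: G)%SET| = (\sum_(a <= k < b.+1)
    (n + k - q) ^_ q * ('C(q, k) * 'C(n - q, alpha - k)))%N.
  (* By [sysE], the number of draws avoiding the core depends on [S] only through the size of
     [S :&: core]. *)
  have := sum_draws_meet alpha (fun k => (n + k - q) ^_ q)%N core_init.
  rewrite card_core card_init => <-.
  have -> : (B :&: G)%SET = finset (fun z : {set V} * {ffun 'I_q -> V} =>
      (z.1 \in replaceable_sets init alpha) &&
      (z.2 \in draws (system_after init new z.1 :\: core)%SET)).
    apply/setP => -[S y]; rewrite !inE /= andbCA; congr andb.
    rewrite andbA; congr andb.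
    apply/andP/ffun_onP => [[/forallP yc /ffun_onP yD] i|yDc].
      by rewrite inE yc yD.
    by split; [apply/forallP|apply/ffun_onP] => i;
      have := yDc i; rewrite inE => /andP[].
  rewrite (card_dependent_pairs _
    (fun S => draws (system_after init new S :\: core)%SET)); apply: eq_bigr => S /sysE[_ cDc].
  by rewrite card_draws_ff cDc.
(* Both [alpha <= n] and [q <= n] enter here: they provide at least one admissible pair. *)
have G_gt0 : (0 < #|G|)%N by rewrite cG muln_gt0 bin_gt0 alpha_le ffact_gt0.
have -> : [set w | forall i, X i w \notin core] =
    [set w | (A w, [ffun i => X i w]) \in B].
  apply/seteqP; split => w /=; rewrite inE /= => Xw.
    by apply/forallP => i; rewrite ffunE.
  by move=> i; have /forallP/(_ i) := Xw; rewrite ffunE.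
rewrite (probability_uniform_support (random_element_pair A_random X_random) _ G_gt0).
  have -> : #|(B :&: G)%SET| = ((\sum_(a <= k < b.+1)
      'C(n + k - q, q) * 'C(q, k) * 'C(n - q, alpha - k)) * q`!)%N.
    by rewrite cBG big_distrl; apply: eq_bigr => k _ /=; rewrite -bin_ffact; ring.
  have -> : #|G| = ('C(n, q) * 'C(n, alpha) * q`!)%N.
    by rewrite cG -bin_ffact mulnCA mulnA.
  by rewrite !(natrM _ _ q`!) -mulf_div divff ?mulr1// pnatr_eq0 -lt0n fact_gt0.
case=> S y; rewrite inE /= => /andP[SA].
rewrite inE => /andP[/ffun_onP yD /injectiveP inj_y].
rewrite -card_new in A_uniform.
rewrite cG -[alpha]card_new.
rewrite -(probability_prefix card_init new_init A_uniform X_drawn _ inj_y yD)//.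
  (* The prefix has length [q], so the condition [j < q] holds for every index and the event fixes
     the whole pair. *)
  congr (P _); apply/seteqP; split => w /=.
    by move=> [-> Xy]; split => // j _; rewrite -Xy ffunE.
  by move=> [-> Xy]; congr pair; apply/ffunP => j; rewrite ffunE Xy.
by rewrite card_new.
Qed.
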